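(* Let $n\in\mathbb N$ and let $e$ be a unitary element of $H_n(\mathbb H_C)$. Let $T:M_n(\mathbb H_C)\to M_n(\mathbb H_C)$ be a mapping such that (a) $T$ is a $*$-isomorphism of $M_n(\mathbb H_C)$ equipped with the product $x\cdot_ey=xe^*y$ and the involution $x^{*_e}=ex^*e$ onto $M_n(\mathbb H_C)$ equipped with its standard C$^*$-algebra structure; (b) $T(x^\diamond)=T(x)^\diamond$ for all $x\in M_n(\mathbb H_C)$ (in particular, $T$ maps $H_n(\mathbb H_C)$ onto $H_n(\mathbb H_C)$). Define $$\operatorname{dt}_{n,e}x=\operatorname{dt}_n(Tx),\qquad x\in H_n(\mathbb H_C).$$ Then: (i) The function $\operatorname{dt}_{n,e}$ does not depend on the concrete choice of $T$ with the properties (a) and (b). (ii) $\operatorname{dt}_nx=\operatorname{dt}_{n,e}x\cdot\operatorname{dt}_ne$ for $x\in H_n(\mathbb H_C)$.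
   Context: Biquaternions $\mathbb H_C$ are the associative algebra $\mathcal A_2$ of the Cayley–Dickson process: $\mathcal A_0=\mathbb C$ with its usual product, $x^\diamond=x$, $x^*=\overline x$; $\mathcal A_{n+1}=\mathcal A_n\times\mathcal A_n$ with $\overline{(x_1,x_2)}=(\overline{x_1},\overline{x_2})$, $(x_1,x_2)^\diamond=(x_1^\diamond,-x_2)$, $(x_1,x_2)^*=(x_1^*,-\overline{x_2})$ and $(x_1,x_2)(y_1,y_2)=(x_1y_1-y_2x_2^\diamond,\ x_1^\diamond y_2+y_1x_2)$. With involution $^*$, $\mathbb H_C$ is a C$^*$-algebra $*$-isomorphic to $M_2(\mathbb C)$, so $M_n(\mathbb H_C)$ with $(x^* )_{ij}=(x_{ji})^*$ is a C$^*$-algebra $*$-isomorphic to $M_{2n}(\mathbb C)$. Put $(x^\diamond)_{ij}=(x_{ji})^\diamond$ and $H_n(\mathbb H_C)=\{x\in M_n(\mathbb H_C):x^\diamond=x\}$ (diagonal entries are then complex numbers). A unitary element of $H_n(\mathbb H_C)$ is an $e\in H_n(\mathbb H_C)$ with $ee^*=e^*e=\mathbf 1$. $(\operatorname{dt}_n)_{n\in\mathbb N}$ is the unique sequence of continuous maps $\operatorname{dt}_n:H_n(\mathbb H_C)\to\mathbb H_C$ with $\operatorname{dt}_1(x_{11})=x_{11}$ and $\operatorname{dt}_{n+1}x=x_{11}\cdot\operatorname{dt}_n(x_{ij}-x_{11}^{-1}x_{i1}x_{1j})_{2\le i,j\le n+1}$ for $x\in H_{n+1}(\mathbb H_C)$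 with $x_{11}\neq0$; its values are complex numbers. *)

(* Defs.v *)
From HB Require Import structures.
From mathcomp Require Import all_boot all_order all_algebra.
From mathcomp Require Import all_classical all_reals all_analysis.
From mathcomp Require Export complex.
From mathcomp Require Import ring.
Set Implicit Arguments.
Unset Strict Implicit.
Unset Printing Implicit Defensive.
Import Order.TTheory GRing.Theory Num.Theory.
Import numFieldNormedType.Exports.

Local Open Scope classical_set_scope.
Local Open Scope complex_scope.
Local Open Scope ring_scope.

(* Cayley-Dickson doubling A x A of an algebra A with product [mul], complex
   conjugation [bar], and involutions [dia] and [star]. *)
Section CayleyDickson.
Variables (A : zmodType) (mul : A -> A -> A) (bar dia star : A -> A).

Definition cd_bar (x : A * A) : A * A := (bar x.1, bar x.2).
Definition cd_dia (x : A * A) : A * A := (dia x.1, - x.2).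
Definition cd_star (x : A * A) : A * A := (star x.1, - bar x.2).
Definition cd_mul (x y : A * A) : A * A :=
  (mul x.1 y.1 - mul y.2 (dia x.2), mul (dia x.1) y.2 + mul y.1 x.2).

End CayleyDickson.

(* [biquat R] is A_2, obtained from A_0 = R[i] by doubling twice. It is an alias
   so that it does not inherit the componentwise product of pairs. *)
Definition biquat (R : realType) : Type := ((R[i] * R[i]) * (R[i] * R[i]))%type.

Section Biquaternions.
Variable R : realType.
Local Notation C := R[i].
Local Notation H := (biquat R).

HB.instance Definition _ := GRing.Zmodule.copy H ((C * C) * (C * C))%type.

Definition A1mul : C * C -> C * C -> C * C := cd_mul *%R id.
Definition A1bar : C * C -> C * C := cd_bar (@conjc R).
Definition A1dia : C * C -> C * C := cd_dia id.
Definition A1star : C * C -> C * C := cd_star (@conjc R) (@conjc R).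

Definition bq_mul : H -> H -> H := cd_mul A1mul A1dia.
Definition bq_dia : H -> H := cd_dia A1dia.
Definition bq_star : H -> H := cd_star A1bar A1star.

Definition bq_of_complex (z : C) : H := ((z, 0), (0, 0)).

Let bq_mulA : associative bq_mul.
Proof.
move=> [[a b] [c d]] [[a' b'] [c' d']] [[a'' b''] [c'' d'']].
by congr ((_, _), (_, _)); rewrite /=; ring.
Qed.

Let bq_mul1x : left_id (bq_of_complex 1) bq_mul.
Proof. by move=> [[a b] [c d]]; congr ((_, _), (_, _)); rewrite /=; ring. Qed.

Let bq_mulx1 : right_id (bq_of_complex 1) bq_mul.
Proof. by move=> [[a b] [c d]]; congr ((_, _), (_, _)); rewrite /=; ring. Qed.

Let bq_mulDl : left_distributive bq_mul +%R.
Proof.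
move=> [[a b] [c d]] [[a' b'] [c' d']] [[a'' b''] [c'' d'']].
by congr ((_, _), (_, _)); rewrite /=; ring.
Qed.

Let bq_mulDr : right_distributive bq_mul +%R.
Proof.
move=> [[a b] [c d]] [[a' b'] [c' d']] [[a'' b''] [c'' d'']].
by congr ((_, _), (_, _)); rewrite /=; ring.
Qed.

Let bq_1neq0 : bq_of_complex 1 != 0.
Proof. by apply/eqP => -[/eqP]; rewrite oner_eq0. Qed.

HB.instance Definition _ := GRing.Zmodule_isNzRing.Build H
  bq_mulA bq_mul1x bq_mulx1 bq_mulDl bq_mulDr bq_1neq0.

(* The usual topology of C^4; [C^o] carries the topology given by the modulus. *)
HB.instance Definition _ :=
  PseudoMetric.copy H ((C^o * C^o) * (C^o * C^o))%type.

End Biquaternions.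

Section BiquaternionMatrices.
Variable R : realType.
Local Notation H := (biquat R).
Local Notation "z %:H" := (@bq_of_complex R z) (at level 2, format "z %:H").

Definition mxstar n (x : 'M[H]_n) : 'M[H]_n := \matrix_(i, j) bq_star (x j i).
Definition mxdia n (x : 'M[H]_n) : 'M[H]_n := \matrix_(i, j) bq_dia (x j i).

(* The space H_n(H_C) of diamond-hermitian matrices. *)
Definition diaherm n : set 'M[H]_n := [set x | mxdia x = x].

Definition unitary n (e : 'M[H]_n) : Prop :=
  e *m mxstar e = 1%:M /\ mxstar e *m e = 1%:M.

(* The recursion step. The corner x_11 of a matrix in H_n(H_C) is a complex
   number, written c here. [a *: x] is entrywise left multiplication by a. *)
Definition schur_step n (c : R[i]) (x : 'M[H]_n.+1) : 'M[H]_n :=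
  \matrix_(i, j) (x (lift ord0 i) (lift ord0 j)
                  - c^-1%:H * x (lift ord0 i) ord0 * x ord0 (lift ord0 j)).

(* [is_dt dt] says that (dt n)_{n >= 1} is the sequence (dt_n). The values of
   [dt 0] and those of [dt n] outside H_n(H_C) are irrelevant. *)
Definition is_dt (dt : forall n, 'M[H]_n -> H) : Prop :=
  [/\ forall n, {within @diaherm n.+1, continuous (dt n.+1)},
      forall x : 'M[H]_1, diaherm x -> dt 1 x = x ord0 ord0
    & forall n (x : 'M[H]_n.+2) (c : R[i]), diaherm x ->
        x ord0 ord0 = c%:H -> c != 0 ->
        dt n.+2 x = c%:H * dt n.+1 (schur_step c x)].

Definition isotope_mul n (e x y : 'M[H]_n) : 'M[H]_n := x *m mxstar e *m y.
Definition isotope_star n (e x : 'M[H]_n) : 'M[H]_n := e *m mxstar x *m e.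

(* [T] is an isomorphism of complex *-algebras from M_n(H_C) with the e-product
   and e-involution onto the standard M_n(H_C). *)
Definition star_iso n (e : 'M[H]_n) (T : 'M[H]_n -> 'M[H]_n) : Prop :=
  [/\ bijective T,
      forall (c : R[i]) x y, T (c%:H *: x + y) = c%:H *: T x + T y,
      forall x y, T (isotope_mul e x y) = T x *m T y
    & forall x, T (isotope_star e x) = mxstar (T x)].

Definition dia_compatible n (T : 'M[H]_n -> 'M[H]_n) : Prop :=
  forall x, T (mxdia x) = mxdia (T x).

Definition dt_isotope (dt : forall n, 'M[H]_n -> H) n
    (T : 'M[H]_n -> 'M[H]_n) (x : 'M[H]_n) : H :=
  dt n (T x).

End BiquaternionMatrices.

(* Main.v *)
(* Writing H_C as M_2(C) identifies M_n(H_C) with M_{2n}(C); let N be the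
   determinant of the resulting complex matrix.  The Schur complement recursion
   gives (dt x)^2 = N x on H_n(H_C) where the corners do not vanish, hence
   everywhere by continuity: dt is a Pfaffian.  The map S y = T (y e) is an
   algebra automorphism of M_{2n}(C), hence inner, so N (T x) N e = N x.
   Therefore dt (T x) dt e and dt x have the same square; they agree at x = e
   because T e = 1.  On the complex line from e to x, N is a polynomial, so e and
   x (when N x is not 0) are joined by an arc avoiding its zeros, along which the
   sign cannot change. *)
From HB Require Import structures.
Require Import Defs.
From mathcomp Require Import all_boot all_order all_algebra.
From mathcomp Require Import all_classical all_reals all_analysis.
From mathcomp Require Import ring.
Set Implicit Arguments.
Unset Strict Implicit.
Unset Printing Implicit Defensive.
Import Order.TTheory GRing.Theory Num.Theory.
Import numFieldNormedType.Exports.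
Local Open Scope classical_set_scope.
Local Open Scope complex_scope.
Local Open Scope ring_scope.

(** * Determinants over a field: algebra endomorphisms and Schur complements *)

(* Skolem-Noether: if [w *m S (delta_mx 0 0) != 0], the rows
   [w *m S (delta_mx 0 i)] form an invertible [P] with [P *m S y = y *m P]. *)
Lemma det_endo_mx (K : fieldType) n (S : 'M[K]_n -> 'M[K]_n) :
  linear S -> injective S -> {morph S : x y / x *m y} ->
  forall x, \det (S x) = \det x.
Proof.
case: n S => [|n] S linS injS mulS x; first by rewrite !det_mx00.
pose Sm := GRing.isLinear.Build _ _ _ _ S linS.
pose SL : {linear _ -> _} := HB.pack S Sm.
have S0 : S 0 = 0 by exact: (linear0 SL).
have SZ a y : S (a *: y) = a *: S y by have := linS a y 0; rewrite S0 !addr0.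
(* By injectivity this image has a nonzero row space; a nonzero [v] in it supplies [w], and [v]
   becomes row 0 of [P]. *)
have /rowV0Pn[v /submxP[w vE] v0] : S (@delta_mx _ n.+1 n.+1 0 0) != 0.
  rewrite -S0; apply: contra_neq (_ : delta_mx 0 0 != 0 :> 'M[K]_n.+1).
    exact: injS.
  by apply/eqP => /matrixP/(_ 0 0)/eqP; rewrite !mxE !eqxx oner_eq0.
pose P : 'M[K]_(n.+1) := \matrix_i (w *m S (delta_mx 0 i)).
have PS y : P *m S y = y *m P.
  apply/row_matrixP => i; rewrite !row_mul rowK.
  rewrite -mulmxA -mulS (_ : delta_mx 0 i *m y = \sum_k y i k *: delta_mx 0 k).
    rewrite [S _](linear_sum SL) mulmx_sumr mulmx_sum_row.
    apply: eq_bigr => k _.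
    by rewrite rowK -[SL _]/(S _) SZ -scalemxAr [row _ _ _ _]mxE.
  apply/matrixP => a b; rewrite !mxE summxE.
  rewrite (bigD1 i) //= big1 ?addr0 => [|k /negbTE ki]; last first.
    by rewrite !mxE ki andbF mul0r.
  rewrite (bigD1 b) //= big1 ?addr0 => [|k /negbTE kb]; last first.
    by rewrite !mxE [b == k]eq_sym kb andbF mulr0.
  by rewrite !mxE !eqxx !andbT mulrC.
have Punit : P \in unitmx.
  rewrite -row_free_unit; apply/row_freeP.
  have P00 : P != 0.
    apply: contra_neq v0 => P0; apply/rowP => j.
    have /rowP/(_ j) : row 0 P = 0 by rewrite P0 linear0.
    by rewrite rowK -vE.
  apply/row_freeP; rewrite -kermx_eq0; apply/rowV0P => u /sub_kermxP uP.
  apply/eqP; apply: contra_neqT P00 => /rV0Pn[k uk].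
  apply/row_matrixP => i; rewrite row0.
  (* Multiplying [u *m P = 0] by [S (delta_mx k i)] gives [u 0 k] times row [i] of [P]; as [u 0 k]
     is nonzero, every row of [P] vanishes. *)
  have := congr1 (mulmx^~ (S (delta_mx k i))) uP.
  rewrite mul0mx -mulmxA PS mulmxA.
  have -> : u *m delta_mx k i = u 0 k *: delta_mx 0 i.
    apply/rowP => j; rewrite !mxE (bigD1 k) //= big1 => [|l /negbTE lk].
      by rewrite !mxE eqxx addr0.
    by rewrite !mxE lk mulr0.
  rewrite -scalemxAl -rowE => /eqP.
  by rewrite scaler_eq0 (negbTE uk) => /eqP.
apply: (mulIf (x := \det P)); first by rewrite -unitfE -unitmxE.
by rewrite mulrC -det_mulmx PS det_mulmx.
Qed.

(** Block Gaussian elimination: a unipotent lower factor times a block upper triangular one. *)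
Lemma det_schur (K : fieldType) m n (a : 'M[K]_m) b c (d : 'M[K]_n) :
  a \in unitmx ->
  \det (block_mx a b c d) = \det a * \det (d - c *m invmx a *m b).
Proof.
move=> aU.
have -> : block_mx a b c d = block_mx 1%:M 0 (c *m invmx a) 1%:M *m
    block_mx a b 0 (d - c *m invmx a *m b).
  by rewrite mulmx_block !mul1mx !mul0mx !addr0 mulmxKV // addrC subrK.
by rewrite det_mulmx det_lblock det_ublock !det1 !mul1r.
Qed.

Lemma det_castmx (K : comRingType) m n (eq_mn : m = n) (A : 'M[K]_m) :
  \det (castmx (eq_mn, eq_mn) A) = \det A.
Proof. by case: n / eq_mn; rewrite castmx_id. Qed.

(** * Biquaternions as complex matrices of size 2 *)

Section ComplexMatrixOfBiquat.
Variable R : realType.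
Local Notation C := R[i].
Local Notation H := (biquat R).
Local Notation "z %:H" := (@bq_of_complex R z) (at level 2, format "z %:H").

(* A_1 is C x C through [(a, b) |-> (a + 'i b, a - 'i b)]; these are the two
   coordinates used for both halves of a biquaternion. *)
Definition bq_mx (x : H) : 'M[C]_2 :=
  \matrix_(i, j)
    if i == 0 then if j == 0 then x.1.1 + 'i * x.1.2 else 'i * x.2.2 - x.2.1
    else if j == 0 then x.2.1 + 'i * x.2.2 else x.1.1 - 'i * x.1.2.

Definition mx_bq (A : 'M[C]_2) : H :=
  (((A 0 0 + A 1 1) / 2, (A 0 0 - A 1 1) / (2 * 'i)),
   ((A 1 0 - A 0 1) / 2, (A 1 0 + A 0 1) / (2 * 'i))).

Let ord2E (P : 'I_2 -> Prop) : P 0 -> P 1 -> forall i, P i.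
Proof.
move=> P0 P1 [[|[|//]] lti].
  by have -> : Ordinal lti = 0 by exact: val_inj.
by have -> : Ordinal lti = 1 by exact: val_inj.
Qed.

Lemma mx_bqK : cancel mx_bq bq_mx.
Proof.
move=> A; apply/matrixP; apply: ord2E; apply: ord2E; rewrite !mxE /=; field.
all: by rewrite ?neq0Ci ?pnatr_eq0.
Qed.

Lemma bq_mxK : cancel bq_mx mx_bq.
Proof.
move=> [[a b] [c d]]; congr ((_, _), (_, _)); rewrite !mxE /=; field.
all: by rewrite ?neq0Ci ?pnatr_eq0.
Qed.

Lemma bq_mxD : {morph bq_mx : x y / x + y}.
Proof.
move=> [[a b] [c d]] [[a' b'] [c' d']].
by apply/matrixP; apply: ord2E; apply: ord2E; rewrite !mxE /=; ring.
Qed.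

Lemma bq_mxM : {morph bq_mx : x y / x * y >-> x *m y}.
Proof.
move=> [[a b] [c d]] [[a' b'] [c' d']].
have ii : 'i * 'i = -1 :> C by rewrite -expr2 sqrCi.
by apply/matrixP; apply: ord2E; apply: ord2E;
   rewrite !mxE big_ord_recl big_ord1 !mxE /=; ring: ii.
Qed.

Lemma bq_mx_complex z : bq_mx z%:H = z%:M.
Proof.
by apply/matrixP; apply: ord2E; apply: ord2E; rewrite !mxE /=; ring.
Qed.

End ComplexMatrixOfBiquat.

(** * Biquaternion matrices as complex block matrices, and their determinant *)

Lemma mxblockZ (K : pzRingType) p q (p_ : 'I_p -> nat) (q_ : 'I_q -> nat)
    (a : K) (B : forall i j, 'M[K]_(p_ i, q_ j)) :
  \mxblock_(i, j) (a *: B i j) = a *: \mxblock_(i, j) B i j.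
Proof. by apply/matrixP => k l; rewrite !mxE. Qed.

Section ComplexMatrixOfBiquatMatrix.
Variable R : realType.
Local Notation C := R[i].
Local Notation H := (biquat R).
Local Notation "z %:H" := (@bq_of_complex R z) (at level 2, format "z %:H").

Lemma bq_mx0 : bq_mx 0 = 0 :> 'M[C]_2.
Proof. by rewrite -[LHS]/(bq_mx (0 : C)%:H) bq_mx_complex raddf0. Qed.

(** The size, equal to 2n, is kept as the sum of the block sizes, which is the form that [\mxblock]
    produces. *)
Definition cplx_mx n (x : 'M[H]_n) : 'M[C]_(\sum_(i < n) 2) :=
  \mxblock_(i, j) bq_mx (x i j).

Definition mx_cplx n (A : 'M[C]_(\sum_(i < n) 2)) : 'M[H]_n :=
  \matrix_(i, j) mx_bq (submxblock A i j).

(** This is the function N of the sketch above. *)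
Definition bqdet n (x : 'M[H]_n) : C := \det (cplx_mx x).

Lemma mx_cplxK n : cancel (@mx_cplx n) (@cplx_mx n).
Proof.
move=> A; rewrite -[RHS]submxblockK; apply: eq_mxblock => i j.
by rewrite mxE mx_bqK.
Qed.

Lemma cplx_mxK n : cancel (@cplx_mx n) (@mx_cplx n).
Proof. by move=> x; apply/matrixP => i j; rewrite mxE mxblockK bq_mxK. Qed.

Lemma cplx_mxD n : {morph @cplx_mx n : x y / x + y}.
Proof.
by move=> x y; rewrite -mxblockD; apply: eq_mxblock => i j; rewrite mxE bq_mxD.
Qed.

Lemma cplx_mxM n : {morph @cplx_mx n : x y / x *m y}.
Proof.
move=> x y; rewrite mul_mxblock; apply: eq_mxblock => i j.
rewrite mxE (big_morph _ (@bq_mxD R) bq_mx0).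
by apply: eq_bigr => k _; rewrite bq_mxM.
Qed.

Lemma cplx_mxZ n (c : C) (x : 'M[H]_n) : cplx_mx (c%:H *: x) = c *: cplx_mx x.
Proof.
rewrite -mxblockZ; apply: eq_mxblock => i j.
by rewrite mxE bq_mxM bq_mx_complex mul_scalar_mx.
Qed.

Lemma bqdetM n : {morph @bqdet n : x y / x *m y >-> x * y}.
Proof. by move=> x y; rewrite -det_mulmx -cplx_mxM. Qed.

(** Multiplicativity and surjectivity suffice: the image of [1%:M] is a left unit for the preimage
    of the complex identity. *)
Lemma cplx_mx1 n : cplx_mx 1%:M = 1%:M :> 'M[C]_(\sum_(i < n) 2).
Proof.
have /(congr1 (@cplx_mx n)) := mul1mx (mx_cplx 1%:M : 'M[H]_n).
by rewrite cplx_mxM mx_cplxK mulmx1.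
Qed.

Lemma bqdet1 n : bqdet (1%:M : 'M[H]_n) = 1.
Proof. by rewrite /bqdet cplx_mx1 det1. Qed.

Lemma bqdet_endo n (S : 'M[H]_n -> 'M[H]_n) :
  injective S -> (forall (c : C) x y, S (c%:H *: x + y) = c%:H *: S x + S y) ->
  {morph S : x y / x *m y} -> forall x, bqdet (S x) = bqdet x.
Proof.
move=> injS linS mulS x; have cK := @cplx_mxK n; have mK := @mx_cplxK n.
have := @det_endo_mx _ _ (@cplx_mx n \o S \o @mx_cplx n) _ _ _ (cplx_mx x).
rewrite /= cK; apply.
- move=> a A B; rewrite -cplx_mxZ -cplx_mxD -linS; congr (cplx_mx (S _)).
  by apply: (can_inj cK); rewrite cplx_mxD cplx_mxZ !mK.
- apply: inj_comp; last exact: can_inj mK.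
  by apply: inj_comp injS; exact: can_inj cK.
- move=> A B; rewrite -cplx_mxM -mulS; congr (cplx_mx (S _)).
  by apply: (can_inj cK); rewrite cplx_mxM !mK.
Qed.

(** This parallels the recursion for [dt]. The factor is squared because the corner becomes a scalar
    block of size 2. *)
Lemma bqdet_schur_step n (c : C) (x : 'M[H]_n.+1) :
  x ord0 ord0 = c%:H -> c != 0 -> bqdet x = c ^+ 2 * bqdet (schur_step c x).
Proof.
move=> x00 c0; rewrite /bqdet /cplx_mx mxblock_recul det_castmx x00.
rewrite bq_mx_complex det_schur; last first.
  by rewrite unitmxE det_scalar unitrX // unitfE.
rewrite det_scalar invmx_scalar mul_mx_scalar -scalemxAl mul_mxcol_mxrow.
congr (_ * \det _); rewrite -mxblockZ -mxblockB.
apply: eq_mxblock => i j; rewrite mxE bq_mxD; congr (_ + _).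
have -> : - (c^-1%:H * x (lift ord0 i) ord0 * x ord0 (lift ord0 j)) =
    (- c^-1)%:H * (x (lift ord0 i) ord0 * x ord0 (lift ord0 j)).
  by rewrite -mulrA -mulNr; congr (_ * _); congr ((_, _), (_, _)); exact: oppr0.
by rewrite !bq_mxM bq_mx_complex mul_scalar_mx scaleNr.
Qed.

Lemma bq_diaM (x y : H) : bq_dia (x * y) = bq_dia y * bq_dia x.
Proof.
case: x y => [[a b] [c d]] [[a' b'] [c' d']].
by congr ((_, _), (_, _)); rewrite /=; ring.
Qed.

(** The diamond involution negates the last three complex coordinates and fixes the first. *)
Lemma bq_dia_fixed (x : H) : bq_dia x = x -> x = (x.1.1)%:H.
Proof.
have opp_fixed (z : C) : - z = z -> z = 0.
  by move=> /eqP; rewrite eqNr => /eqP.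
case: x => [[a b] [c d]] [/opp_fixed -> /opp_fixed -> /opp_fixed ->] //.
Qed.

Lemma bq_complexC (z : C) (x : H) : z%:H * x = x * z%:H.
Proof.
case: x => [[a b] [c d]].
by congr ((_, _), (_, _)); rewrite /=; ring.
Qed.

Lemma bq_complexM (z w : C) : (z * w)%:H = z%:H * w%:H.
Proof. by congr ((_, _), (_, _)); rewrite /=; ring. Qed.

Lemma diaherm_corner n (x : 'M[H]_n.+1) : diaherm x ->
  x ord0 ord0 = (x ord0 ord0).1.1%:H.
Proof. by move=> hx; apply: bq_dia_fixed; rewrite -{2}hx mxE. Qed.

Lemma bq_diaD (x y : H) : bq_dia (x + y) = bq_dia x + bq_dia y.
Proof.
case: x y => [[a b] [c d]] [[a' b'] [c' d']].
by congr ((_, _), (_, _)); rewrite /= ?opprD.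
Qed.

Lemma bq_diaN (x : H) : bq_dia (- x) = - bq_dia x.
Proof. by case: x => [[a b] [c d]]. Qed.

Lemma bq_dia_complex (z : C) : bq_dia z%:H = z%:H.
Proof. by congr ((_, _), (_, _)); exact: oppr0. Qed.

(** The diamond involution reverses the product of the two border entries, and complex scalars are
    central. *)
Lemma diaherm_schur_step n c (x : 'M[H]_n.+1) :
  diaherm x -> diaherm (schur_step c x).
Proof.
move=> hx; have xE i j : bq_dia (x i j) = x j i by rewrite -{2}hx mxE.
apply/matrixP => i j; rewrite !mxE bq_diaD bq_diaN !bq_diaM !xE.
by rewrite bq_dia_complex -[in RHS]mulrA bq_complexC mulrA.
Qed.

Lemma diaherm_affine n (c : C) (x y : 'M[H]_n) :
  diaherm x -> diaherm y -> diaherm (x + c%:H *: y).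
Proof.
move=> hx hy; apply/matrixP => i j; rewrite !mxE bq_diaD bq_diaM.
by rewrite bq_dia_complex -bq_complexC -{2}hx -{2}hy !mxE.
Qed.

(** The witness is the determinant of a matrix pencil over the polynomial ring; evaluation at [c] is
    a ring morphism, so it commutes with [\det]. *)
Lemma bqdet_affine n (x y : 'M[H]_n) :
  exists p : {poly C}, forall c : C, bqdet (x + c%:H *: y) = p.[c].
Proof.
exists (\det (map_mx polyC (cplx_mx x) + 'X *: map_mx polyC (cplx_mx y))) => c.
rewrite -horner_evalE -det_map_mx; congr (\det _).
rewrite cplx_mxD cplx_mxZ; apply/matrixP => i j.
by rewrite !mxE /= horner_evalE !hornerE.
Qed.

Lemma diaherm1 n : diaherm (1%:M : 'M[H]_n).
Proof.
apply/matrixP => i j; rewrite !mxE eq_sym; case: (i == j).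
  exact: bq_dia_complex.
exact: (bq_dia_complex 0).
Qed.

Lemma dt_one (dt : forall n, 'M[H]_n -> H) n : is_dt dt -> dt n.+1 1%:M = 1.
Proof.
move=> [_ dt1 dtS]; elim: n => [|n IHn].
  by rewrite dt1 ?mxE //; exact: diaherm1.
rewrite (dtS _ _ 1 (diaherm1 _)) ?oner_neq0 ?mxE //.
rewrite (_ : schur_step _ _ = 1%:M) ?IHn ?mulr1 //.
by apply/matrixP => i j; rewrite !mxE /= mulr0 subr0.
Qed.

End ComplexMatrixOfBiquatMatrix.

(** * Continuity along affine curves *)

Lemma cvg_mx (I : Type) (F : set_system I) {FF : Filter F} (T : topologicalType)
    m n (g : I -> 'M[T]_(m, n)) (M : 'M[T]_(m, n)) :
  (forall i j, g u i j @[u --> F] --> M i j) -> g @ F --> M.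
Proof.
move=> gM A [P nP PA]; rewrite nbhs_filterE /=.
suff : \forall u \near F, forall i j, P i j (g u i j).
  by apply: filterS => u gP; apply: PA.
apply: filter_forall => i; apply: filter_forall => j.
exact: (gM i j _ (nP i j)).
Qed.

Lemma horner_continuous (K : numFieldType) (p : {poly K}) :
  continuous (fun x : K => p.[x]).
Proof.
elim/poly_ind: p => [|p c IHp].
  have -> : horner (0 : {poly K}) = cst 0 by apply/funext => x; rewrite horner0.
  exact: cst_continuous.
have -> : horner (p * 'X + c%:P) = (fun x => p.[x] * x + c).
  by apply/funext => x; rewrite hornerMXaddC.
move=> x; exact: (cvgD (cvgM (IHp x) cvg_id) (cvg_cst _)).
Qed.

Section Continuity.
Variable R : realType.
Local Notation C := R[i].
Local Notation H := (biquat R).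
Local Notation "z %:H" := (@bq_of_complex R z) (at level 2, format "z %:H").

Lemma continuous_Re : continuous (fun z : C^o => complex.Re z).
Proof.
move=> z; apply/(@cvgrPdist_lt _ R^o _ _ (@nbhs_filter C^o z)) => eps eps0.
apply/nbhs_ballP.
exists eps%:C; first by rewrite /= ltcR.
move=> w; rewrite /ball /= => zw; rewrite -ltcR; apply: le_lt_trans zw.
by rewrite -(raddfB (@complex.Re R)); exact: normc_ge_Re.
Qed.

Lemma continuous_real_complex : continuous (fun t : R => t%:C : C^o).
Proof.
move=> t; apply/(@cvgrPdist_lt _ C^o) => eps.
rewrite ltcE => /andP[/eqP/= eps0 eps1]; near=> s.
rewrite -rmorphB normc_def /= expr0n addr0 sqrtr_sqr ltcE /= eps0 eqxx.
near: s; exact: (nbhsx_ballx (t : R^o) _ eps1).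
Unshelve. all: by end_near.
Qed.

(** The topology is that of pairs of pairs, so the criterion for pairs is applied twice. *)
Lemma cvg_bq (I : Type) (F : set_system I) {FF : Filter F} (f : I -> H) (x : H):
  f u @[u --> F] --> x <->
  [/\ ((f u).1.1 : C^o) @[u --> F] --> (x.1.1 : C^o),
      ((f u).1.2 : C^o) @[u --> F] --> (x.1.2 : C^o),
      ((f u).2.1 : C^o) @[u --> F] --> (x.2.1 : C^o) &
      ((f u).2.2 : C^o) @[u --> F] --> (x.2.2 : C^o)].
Proof.
split=> [fx | [f1 f2 f3 f4]].
  have f1 : (f u).1 @[u --> F] --> (x.1 : C^o * C^o).
    apply: (cvg_comp _ _ fx).
    exact: (@cvg_fst _ _ _ (nbhs (x.2 : C^o * C^o)) _).
  have f2 : (f u).2 @[u --> F] --> (x.2 : C^o * C^o).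
    apply: (cvg_comp _ _ fx).
    exact: (@cvg_snd _ _ (nbhs (x.1 : C^o * C^o)) _ _).
  split.
  - apply: (cvg_comp _ _ f1); exact: (@cvg_fst _ _ _ (nbhs (x.1.2 : C^o)) _).
  - apply: (cvg_comp _ _ f1); exact: (@cvg_snd _ _ (nbhs (x.1.1 : C^o)) _ _).
  - apply: (cvg_comp _ _ f2); exact: (@cvg_fst _ _ _ (nbhs (x.2.2 : C^o)) _).
  - apply: (cvg_comp _ _ f2); exact: (@cvg_snd _ _ (nbhs (x.2.1 : C^o)) _ _).
have f12 := @cvg_pair _ _ _ F _ _ FF
  (@nbhs_filter C^o _) (@nbhs_filter C^o _) _ _ f1 f2.
have f34 := @cvg_pair _ _ _ F _ _ FF
  (@nbhs_filter C^o _) (@nbhs_filter C^o _) _ _ f3 f4.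
have := @cvg_pair _ _ _ F _ _ FF
  (filter_prod_filter _ _) (filter_prod_filter _ _) _ _ f12 f34.
rewrite (_ : (fun u => _) = f); last first.
  by apply/funext => u; case: (f u) => [[? ?] [? ?]].
exact.
Qed.

Lemma continuous_bq_affine (x y : H) (p : R -> C^o) : continuous p ->
  continuous (fun u => x + (p u : C)%:H * y).
Proof.
move=> cp u.
have cvgp (a b : C^o) : a + p v * b @[v --> u] --> a + p u * b.
  apply: (@cvgD C C^o); first exact: cvg_cst.
  by apply: (@cvgM C); [exact: cp|exact: cvg_cst].
have E v : x + (p v : C)%:H * y =
    ((x.1.1 + p v * y.1.1, x.1.2 + p v * y.1.2),
     (x.2.1 + p v * y.2.1, x.2.2 + p v * y.2.2)).
  case: x y => [[a b] [c d]] [[a' b'] [c' d']].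
  by congr ((_, _), (_, _)); rewrite /=; ring.
apply/(@cvg_bq _ _ (@nbhs_filter R u)); split.
- have E11 v := congr1 (fun h : H => h.1.1) (E v).
  by rewrite (funext E11) E11; exact: cvgp.
- have E12 v := congr1 (fun h : H => h.1.2) (E v).
  by rewrite (funext E12) E12; exact: cvgp.
- have E21 v := congr1 (fun h : H => h.2.1) (E v).
  by rewrite (funext E21) E21; exact: cvgp.
- have E22 v := congr1 (fun h : H => h.2.2) (E v).
  by rewrite (funext E22) E22; exact: cvgp.
Qed.

(** Continuity of [dt] is given only within the diamond-hermitian matrices; the curve stays among
    them, so the composite is continuous in the ordinary sense. *)
Lemma continuous_dt_affine (dt : forall n, 'M[H]_n -> H) n (x y : 'M[H]_n.+1)
    (p : R -> C^o) :
  is_dt dt -> diaherm x -> diaherm y -> continuous p ->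
  continuous (fun u => dt n.+1 (x + (p u : C)%:H *: y)).
Proof.
move=> [/(_ n) + _ _] hx hy cp u; move/subspace_continuousP => cdt.
have hxy v : diaherm (x + (p v : C)%:H *: y) by exact: diaherm_affine.
apply: cvg_comp (cdt _ (hxy u)).
have cxy : x + (p v : C)%:H *: y @[v --> u] --> x + (p u : C)%:H *: y.
  apply: (@cvg_mx R (nbhs u) (@nbhs_filter R u) H) => i j.
  have Eij v : (x + (p v : C)%:H *: y) i j = x i j + (p v : C)%:H * y i j.
    by rewrite !mxE.
  rewrite (funext Eij) Eij.
  exact: (@continuous_bq_affine (x i j) (y i j) p cp u).
by move=> A /cxy; apply: (@filterS _ _ (@nbhs_filter R u)) => v; apply.
Qed.

(** Uniqueness of the limit along the punctured neighbourhoods of 0. *)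
Lemma continuous_eq0_punctured (f : R -> C^o) : continuous f ->
  (forall t, t != 0 -> f t = 0) -> f 0 = 0.
Proof.
move=> cf f0.
have f00 : f t @[t --> 0^'] --> (0 : C^o).
  apply: cvg_near_cst; near=> t; apply: f0.
  by near: t; exact: nbhs_dnbhs_neq.
have f0' : f t @[t --> 0^'] --> f 0.
  by apply: cvg_trans (cf 0); apply: cvg_app; exact: nbhs_dnbhs.
apply: (cvg_unique _ f0' f00).
exact: norm_hausdorff.
Unshelve. all: by end_near.
Qed.

End Continuity.

(** * The square of [dt] is the complex determinant *)

Section Dt.
Variable R : realType.
Local Notation C := R[i].
Local Notation H := (biquat R).
Local Notation "z %:H" := (@bq_of_complex R z) (at level 2, format "z %:H").
Variables (dt : forall n, 'M[H]_n -> H) (dtP : is_dt dt).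

Lemma dt_sqr n (x : 'M[H]_n.+1) : diaherm x ->
  exists2 z : C, dt x = z%:H & z ^+ 2 = bqdet x.
Proof.
elim: n x => [|n IHn] x hx; have xc := diaherm_corner hx.
  have [_ -> //] := dtP; exists (x ord0 ord0).1.1 => //.
  (* A matrix of size 1 is a complex scalar, so its complex matrix is scalar of size 2 and has
     determinant the square of that scalar. *)
  have xE : x = (x ord0 ord0).1.1%:H *: 1%:M.
    by apply/matrixP => i j; rewrite !ord1 -xc !mxE mulr1.
  by rewrite [in RHS]xE /bqdet cplx_mxZ cplx_mx1 detZ det1 mulr1 big_ord1.
have dt_corner (y : 'M[H]_n.+2) (c : C) : diaherm y -> y ord0 ord0 = c%:H ->
    c != 0 -> exists2 z : C, dt y = z%:H & z ^+ 2 = bqdet y.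
  move=> hy yc c0; have [_ _ /(_ _ _ _ hy yc c0) ->] := dtP.
  have [z -> zz] := IHn _ (diaherm_schur_step c hy).
  exists (c * z); first by rewrite bq_complexM.
  by rewrite exprMn zz (bqdet_schur_step yc).
have [c0|] := eqVneq (x ord0 ord0).1.1 0; last exact: dt_corner.
(* The corner vanishes: perturb it and let the perturbation tend to 0. *)
pose E : 'M[H]_n.+2 := delta_mx ord0 ord0.
have hE : diaherm E.
  apply/matrixP => i j; rewrite !mxE andbC.
  by case: (_ && _); [exact: (bq_dia_complex 1)|exact: (bq_dia_complex 0)].
pose F (t : R) := dt (x + (t%:C)%:H *: E).
have cF : continuous F.
  exact: (continuous_dt_affine dtP hx hE (@continuous_real_complex R)).
have F0 : F 0 = dt x by rewrite /F scale0r addr0.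
have [p pE] := bqdet_affine x E.
have Fsqr t : t != 0 -> exists2 z : C, F t = z%:H & z ^+ 2 = p.[t%:C].
  move=> t0; rewrite -pE; apply: (dt_corner _ t%:C).
  - exact: diaherm_affine.
  - by rewrite !mxE !eqxx xc c0 mulr1; congr ((_, _), (_, _)); rewrite /= add0r.
  - by rewrite eq_complex /= eqxx andbT.
have cF4 t := (@cvg_bq R R _ (@nbhs_filter R t) F (F t)).1 (cF t).
(* The square identity and the vanishing of the other three coordinates hold for nonzero [t], and
   pass to [t = 0] by continuity. *)
have z2 : (F 0).1.1 ^+ 2 - p.[0] = 0.
  apply: (@continuous_eq0_punctured R (fun t => (F t).1.1 ^+ 2 - p.[t%:C])).
    move=> t; have [c1 _ _ _] := cF4 t.
    apply: (@cvgB _ C^o); first exact: (@cvgM C _ _ _ _ _ _ _ c1 c1).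
    apply: (cvg_comp _ _ (@continuous_real_complex R t)).
    exact: horner_continuous.
  by move=> t /Fsqr[z -> <-]; rewrite subrr.
have z12 : (F 0).1.2 = 0.
  apply: (@continuous_eq0_punctured R (fun t => (F t).1.2));
    last by move=> t /Fsqr[z ->].
  move=> t; have [_ c _ _] := cF4 t; exact: c.
have z21 : (F 0).2.1 = 0.
  apply: (@continuous_eq0_punctured R (fun t => (F t).2.1));
    last by move=> t /Fsqr[z ->].
  move=> t; have [_ _ c _] := cF4 t; exact: c.
have z22 : (F 0).2.2 = 0.
  apply: (@continuous_eq0_punctured R (fun t => (F t).2.2));
    last by move=> t /Fsqr[z ->].
  move=> t; have [_ _ _ c] := cF4 t; exact: c.
exists (dt x).1.1; rewrite -F0.
  by move: z12 z21 z22; case: (F 0) => [[a b] [c d]] /= -> -> ->.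
by move/eqP: z2; rewrite subr_eq0 => /eqP ->; rewrite -pE scale0r addr0.
Qed.

End Dt.

(** * Arcs avoiding the roots of a polynomial, and constancy of sign *)

Lemma exists_notin (K : realDomainType) (s : seq K) : exists x, x \notin s.
Proof.
have lub x : x \in s -> `|x| <= \sum_(y <- s) `|y|.
  by move=> xs; rewrite (big_rem _ xs) /= lerDl sumr_ge0.
exists (\sum_(y <- s) `|y| + 1); apply/negP => /lub.
rewrite ger0_norm ?addr_ge0 ?sumr_ge0 //.
by rewrite leNgt ltrDl ltr01.
Qed.

Section Path.
Variable R : realType.
Local Notation C := R[i].

(* A point [z] other than 0 and 1 lies on [bent_arc s] for at most one [s],
   namely [Im z / (Re z * (1 - Re z))]. *)
Definition bent_arc (s u : R) : C := u%:C + (0 +i* s) * (u * (1 - u))%:C.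

Lemma continuous_bent_arc s : continuous (bent_arc s : R -> C^o).
Proof.
move=> u; apply: (@cvgD C C^o); first exact: continuous_real_complex.
apply: (@cvgM C); first exact: cvg_cst.
apply: (@cvg_comp _ _ _ (fun v : R => v * (1 - v))); last first.
  exact: continuous_real_complex.
apply: (@cvgM R); first exact: cvg_id.
by apply: (@cvgB R R^o); [exact: cvg_cst|exact: cvg_id].
Qed.

(** Each of the finitely many roots rules out at most one [s]; the endpoints 0 and 1, common to all
    arcs, are covered by the hypotheses. *)
Lemma bent_arc_avoid_roots (p : {poly C}) : p.[0] != 0 -> p.[1] != 0 ->
  exists s, forall u, p.[bent_arc s u] != 0.
Proof.
move=> p0 p1; have [rs pE] := closed_field_poly_normal p.
have rootE z : p.[z] = 0 -> z \in rs.
  move/eqP; rewrite -[_ == 0]/(root p z) pE rootZ ?root_prod_XsubC //.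
  by rewrite lead_coef_eq0; apply: contra_neq p0 => ->; rewrite horner0.
have [s sP] := exists_notin
  [seq complex.Im z / (complex.Re z * (1 - complex.Re z)) | z <- rs].
exists s => u; apply: contra sP => /eqP pu; apply/mapP.
exists (bent_arc s u); first exact: rootE.
have -> : complex.Re (bent_arc s u) = u by rewrite /bent_arc /=; ring.
have -> : complex.Im (bent_arc s u) = s * (u * (1 - u)).
  by rewrite /bent_arc /=; ring.
(* The slope formula divides by [u * (1 - u)]; where this vanishes, the arc is at an endpoint, which
   is no root. *)
rewrite mulfK //; apply/negP => /eqP uu.
have pu' : p.[u%:C] = 0 by rewrite -[RHS]pu /bent_arc uu mulr0 addr0.
move/eqP: uu; rewrite mulf_eq0 subr_eq0 => /orP[/eqP u0|/eqP u1].
  by move: pu'; rewrite u0 => /eqP; exact/negP.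
by move: pu'; rewrite -u1 => /eqP; exact/negP.
Qed.

(** The quotient [f / g] takes only the values 1 and -1. Its real part is continuous and starts at
    1; ending at -1 would force a zero by the intermediate value theorem. *)
Lemma sqr_eq_continuous (f g : R -> C^o) : continuous f -> continuous g ->
  (forall u, f u ^+ 2 = g u ^+ 2) -> (forall u, g u != 0) ->
  f 0 = g 0 -> f 1 = g 1.
Proof.
move=> cf cg fg g0 fg0; pose q u := complex.Re (f u / g u : C).
have qE u : f u / g u = 1 \/ f u / g u = -1.
  by apply/pred2P; rewrite -sqrf_eq1 exprMn exprVn fg divff // sqrf_eq0.
have cq : continuous q.
  move=> u; apply: (@cvg_comp _ _ _ (fun v => f v / g v : C^o)); last first.
    exact: continuous_Re.
  apply: (@cvgM C); first exact: cf.
  by apply: (@cvgV C); [exact: g0|exact: cg].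
have [q1|q1] := qE 1; first by rewrite -[LHS](divfK (g0 1)) q1 mul1r.
have q0E : q 0 = 1 by rewrite /q fg0 divff.
have q1E : q 1 = -1 by rewrite /q q1.
have [||u _ qu] := @IVT R q 0 1 0 ler01.
- exact: continuous_subspaceT.
- by rewrite q0E q1E; rewrite ge_min le_max ler01 lerN10 orbT.
by move: qu; rewrite /q; case: (qE u) => -> /= /eqP; rewrite ?oppr_eq0 oner_eq0.
Qed.

End Path.

(** * Comparison of [dt] with its isotope *)

Section Isotope.
Variable R : realType.
Local Notation C := R[i].
Local Notation H := (biquat R).
Local Notation "z %:H" := (@bq_of_complex R z) (at level 2, format "z %:H").
Variables (dt : forall n, 'M[H]_n -> H) (dtP : is_dt dt).

(** With [S y = T (y *m e)], [T x] is [S (x *m mxstar e)]. Since [e *m mxstar e = 1%:M], [S] is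
    multiplicative for the standard product and preserves [bqdet]. *)
Lemma bqdet_star_iso n (e : 'M[H]_n) (T : 'M[H]_n -> 'M[H]_n) x :
  unitary e -> star_iso e T -> bqdet (T x) * bqdet e = bqdet x.
Proof.
move=> [ee' e'e] [/bij_inj injT linT mulT _].
have -> : T x = T (x *m mxstar e *m e) by rewrite -mulmxA e'e mulmx1.
rewrite (bqdet_endo (S := fun y => T (y *m e))).
- by rewrite -bqdetM -mulmxA e'e mulmx1.
- move=> y z /injT /(congr1 (mulmx^~ (mxstar e))).
  by rewrite -!mulmxA ee' !mulmx1.
- by move=> c y z; rewrite mulmxDl -scalemxAl linT.
by move=> y z; rewrite -mulT /isotope_mul -!mulmxA [e *m _]mulmxA ee' mul1mx.
Qed.

(** The unit of the isotope product is [e], and a surjective multiplicative map sends unit to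
    unit. *)
Lemma star_iso_unit n (e : 'M[H]_n) (T : 'M[H]_n -> 'M[H]_n) :
  unitary e -> star_iso e T -> T e = 1%:M.
Proof.
move=> [ee' _] [[T' _ T'K] _ mulT _].
by rewrite -[LHS]mulmx1 -(T'K 1%:M) -mulT /isotope_mul ee' mul1mx.
Qed.

Lemma bqdet_unitary_neq0 n (e : 'M[H]_n) : unitary e -> bqdet e != 0.
Proof.
move=> [ee' _]; have := bqdet1 R n; rewrite -ee' bqdetM => /eqP.
by apply: contraTneq => ->; rewrite mul0r eq_sym oner_eq0.
Qed.

Lemma continuous_dt_affine_complex n (x y : 'M[H]_n.+1) (p : R -> C^o) :
  diaherm x -> diaherm y -> continuous p ->
  continuous (fun u => (dt (x + (p u : C)%:H *: y)).1.1 : C^o).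
Proof.
move=> hx hy cp u; have cdt := continuous_dt_affine dtP hx hy cp.
have [c _ _ _] := (@cvg_bq R R _ (@nbhs_filter R u) _ _).1 (cdt u).
exact: c.
Qed.

Lemma dt_isotopeE n (e x : 'M[H]_n.+1) (T : 'M[H]_n.+1 -> 'M[H]_n.+1) :
  diaherm e -> unitary e -> star_iso e T -> dia_compatible T -> diaherm x ->
  dt x = dt_isotope dt T x * dt e.
Proof.
move=> he ue isoT diaT hx; have [_ linT _ _] := isoT.
have hT y : diaherm y -> diaherm (T y).
  by move=> hy; rewrite /diaherm /= -diaT hy.
have Te := star_iso_unit ue isoT.
have [de dte de2] := dt_sqr dtP he.
have [dx dtx dx2] := dt_sqr dtP hx.
have [dTx dtTx dTx2] := dt_sqr dtP (hT x hx).
have de0 : de != 0 by rewrite -sqrf_eq0 de2 bqdet_unitary_neq0.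
rewrite /dt_isotope dtx dtTx dte -bq_complexM; congr _%:H.
(* If [dx = 0], both sides have square [bqdet x = 0]. Otherwise [bqdet] is nonzero at both ends of
   the arc from [e] to [x]. *)
have [dx0|dx_neq0] := eqVneq dx 0.
  apply/eqP; rewrite dx0 eq_sym -sqrf_eq0 exprMn dTx2 de2 bqdet_star_iso //.
  by rewrite -dx2 dx0 expr0n.
(* The direction of the complex line with [e] at parameter 0 and [x] at parameter 1. *)
pose y := x - e.
have hy : diaherm y.
  have -> : y = x + (-1)%:H *: e.
    rewrite /y -scaleN1r; congr (_ + _ *: _).
    by congr ((_, _), (_, _)); exact: oppr0.
  exact: diaherm_affine.
have Ty : T x = T e + T y.
  by have := linT 1 y e; rewrite !scale1r /y subrK addrC.
have [p pE] := bqdet_affine e y.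
have [s sP] : exists s, forall u, p.[bent_arc s u] != 0.
  apply: bent_arc_avoid_roots; rewrite -pE.
    by rewrite scale0r addr0 bqdet_unitary_neq0.
  by rewrite scale1r /y addrC subrK -dx2 sqrf_eq0.
have Tz u : T (e + (bent_arc s u)%:H *: y) = T e + (bent_arc s u)%:H *: T y.
  by rewrite addrC linT addrC.
(* [f] and [g] are the two sides of the claim along the arc; both square to the value of [p], which
   is nowhere zero there. *)
pose f u := (dt (e + (bent_arc s u)%:H *: y)).1.1.
pose g u := (dt (T e + (bent_arc s u)%:H *: T y)).1.1 * de.
have cf : continuous (f : R -> C^o).
  exact: (continuous_dt_affine_complex he hy (@continuous_bent_arc R s)).
have cg : continuous (g : R -> C^o).
  move=> u; apply: (@cvgM C); last exact: cvg_cst.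
  exact: (continuous_dt_affine_complex (hT e he) (hT y hy)
    (@continuous_bent_arc R s)).
have hz u : diaherm (e + (bent_arc s u)%:H *: y) by exact: diaherm_affine.
have f2 u : f u ^+ 2 = p.[bent_arc s u].
  by rewrite -pE /f; have [z -> <-] := dt_sqr dtP (hz u).
have g2 u : g u ^+ 2 = p.[bent_arc s u].
  rewrite -pE /g -(bqdet_star_iso _ ue isoT) exprMn de2 -Tz.
  by have [z -> <-] := dt_sqr dtP (hT _ (hz u)).
have fg u : f u ^+ 2 = g u ^+ 2 by rewrite f2 g2.
have g0 u : g u != 0 by rewrite -sqrf_eq0 g2.
have := sqr_eq_continuous cf cg fg g0.
have bent_arc0 : bent_arc s 0 = 0 by rewrite /bent_arc mul0r mulr0 addr0.
have bent_arc1 : bent_arc s 1 = 1 by rewrite /bent_arc subrr !mulr0 addr0.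
(* At parameter 0 the two sides agree, since [T e = 1%:M] and [dt] of the identity is 1; at
   parameter 1 they give the claim. *)
rewrite /f /g bent_arc0 bent_arc1 !scale0r !scale1r !addr0 -Ty /y.
rewrite [e + _]addrC subrK.
rewrite dtx dtTx dte Te dt_one //= mul1r; exact.
Qed.

End Isotope.

Theorem proposition5p3 (R : realType)
    (dt : forall n, 'M[biquat R]_n -> biquat R) (dtP : is_dt dt)
    (n : nat) (n_gt0 : (0 < n)%N)
    (e : 'M[biquat R]_n) (e_herm : diaherm e) (e_unitary : unitary e) :
  (forall T1 T2 : 'M[biquat R]_n -> 'M[biquat R]_n,
     star_iso e T1 -> dia_compatible T1 ->
     star_iso e T2 -> dia_compatible T2 ->
     forall x, diaherm x -> dt_isotope dt T1 x = dt_isotope dt T2 x) /\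
  (forall T : 'M[biquat R]_n -> 'M[biquat R]_n,
     star_iso e T -> dia_compatible T ->
     forall x, diaherm x -> dt n x = dt_isotope dt T x * dt n e).
Proof.
case: n n_gt0 e e_herm e_unitary => // n _ e he ue; split; last first.
  by move=> T isoT diaT x hx; exact: dt_isotopeE.
(* Claim (i) follows from (ii): [dt e] is a complex number with nonzero square [bqdet e], so it
   cancels on the right. *)
move=> T1 T2 iso1 dia1 iso2 dia2 x hx.
have [z dte z2] := dt_sqr dtP he.
have z0 : z != 0 by rewrite -sqrf_eq0 z2 bqdet_unitary_neq0.
have zK : bq_of_complex z * bq_of_complex z^-1 = 1.
  by rewrite -bq_complexM divff.
have : dt_isotope dt T1 x * dt n.+1 e = dt_isotope dt T2 x * dt n.+1 e.
  by rewrite -!(dt_isotopeE dtP (e := e)).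
rewrite dte => /(congr1 (fun h => h * bq_of_complex z^-1)).
by rewrite -!mulrA zK !mulr1.
Qed.
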